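(* Let $k\geqslant 2$ be an integer and let $m\geqslant 4k^4$. If $G$ is a simple graph with exactly $m$ edges that is $F_k$-free, then $$\rho(G)\leqslant \frac{k-1+\sqrt{4m-k^2-1}}{2},$$ with equality if and only if $G\cong K_k\vee\left(\frac{m}{k}-\frac{k-1}{2}\right)K_1$.
   Context: $F_k$ (the friendship graph) is the graph consisting of $k$ triangles that share exactly one common vertex (and are otherwise disjoint). A graph is $F_k$-free if it contains no subgraph isomorphic to $F_k$. $\rho(G)$ denotes the spectral radius (largest eigenvalue) of the adjacency matrix of $G$. $K_k$ is the complete graph on $k$ vertices, $tK_1$ is the edgeless graph on $t$ vertices, and $G_1\vee G_2$ denotes the join: the disjoint union of $G_1$ and $G_2$ together with all edges between $V(G_1)$ and $V(G_2)$.
   Formalization: The bound is proved with 4m−k²+1 under the square root instead of 4m−k²−1 (the stated extremal graph K_k∨tK_1 violates the printed bound), and in the equality case the isomorphism is for G with its isolated vertices removed. *)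

(* Defs.v *)
From HB Require Import structures.
From mathcomp Require Import all_boot all_order all_algebra.
From mathcomp Require Import classical_sets reals.
Set Implicit Arguments.
Unset Strict Implicit.
Unset Printing Implicit Defensive.
Import Order.TTheory GRing.Theory Num.Theory.
Local Open Scope ring_scope.

Record sgraph := SGraph {
  vertex :> finType;
  adj : rel vertex;
  adj_sym : symmetric adj;
  adj_irrefl : irreflexive adj }.

Definition edges (G : sgraph) : {set {set G}} :=
  [set [set p.1; p.2] | p : G * G & adj p.1 p.2].

Definition contains_subgraph (G H : sgraph) : Prop :=
  exists f : H -> G, injective f /\ forall x y, adj x y -> adj (f x) (f y).

Definition isomorphic (G H : sgraph) : Prop :=
  exists f : G -> H, bijective f /\ forall x y, adj (f x) (f y) = adj x y.

Section Complete.
Variable n : nat.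
Definition complete_adj : rel 'I_n := fun x y => x != y.
Fact complete_sym : symmetric complete_adj.
Proof. by move=> x y; rewrite /complete_adj eq_sym. Qed.
Fact complete_irrefl : irreflexive complete_adj.
Proof. by move=> x; rewrite /complete_adj eqxx. Qed.
Definition complete_graph := SGraph complete_sym complete_irrefl.
End Complete.

Section Edgeless.
Variable n : nat.
Definition edgeless_adj : rel 'I_n := fun _ _ => false.
Fact edgeless_sym : symmetric edgeless_adj. Proof. by []. Qed.
Fact edgeless_irrefl : irreflexive edgeless_adj. Proof. by []. Qed.
Definition edgeless_graph := SGraph edgeless_sym edgeless_irrefl.
End Edgeless.

Section Join.
Variables G H : sgraph.
Definition join_adj : rel (G + H)%type := fun u v =>
  match u, v with
  | inl x, inl y => adj x y
  | inr x, inr y => adj x y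
  | _, _ => true
  end.
Fact join_sym : symmetric join_adj.
Proof. by move=> [x|x] [y|y] //=; apply: adj_sym. Qed.
Fact join_irrefl : irreflexive join_adj.
Proof. by move=> [x|x] /=; apply: adj_irrefl. Qed.
Definition join_graph := SGraph join_sym join_irrefl.
End Join.

(* [None] is the common vertex; the i-th triangle has vertices [None],
   [Some (i, false)] and [Some (i, true)]. *)
Section Friendship.
Variable k : nat.
Definition friendship_adj : rel (option ('I_k * bool)) := fun u v =>
  match u, v with
  | None, None => false
  | Some p, Some q => (p.1 == q.1) && (p.2 != q.2)
  | _, _ => true
  end.
Fact friendship_sym : symmetric friendship_adj.
Proof. by move=> [p|] [q|] //=; rewrite eq_sym [p.2 == _]eq_sym. Qed.
Fact friendship_irrefl : irreflexive friendship_adj.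
Proof. by move=> [p|] //=; rewrite !eqxx. Qed.
Definition friendship_graph := SGraph friendship_sym friendship_irrefl.
End Friendship.

(* Induced subgraph on the vertices of positive degree. *)
Section DropIsolated.
Variable G : sgraph.
Definition noniso_adj : rel {x : G | [exists y, adj x y]} :=
  fun u v => adj (val u) (val v).
Fact noniso_sym : symmetric noniso_adj.
Proof. by move=> u v; apply: adj_sym. Qed.
Fact noniso_irrefl : irreflexive noniso_adj.
Proof. by move=> u; apply: adj_irrefl. Qed.
Definition drop_isolated := SGraph noniso_sym noniso_irrefl.
End DropIsolated.

Definition adjacency_mx (R : realType) (G : sgraph) : 'M[R]_#|G| :=
  \matrix_(i, j) (adj (enum_val i) (enum_val j))%:R.

(* The adjacency matrix is real symmetric, so for a nonempty graph its set of
   real eigenvalues is finite and nonempty and [sup] is the largest one. *)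
Definition spectral_radius (R : realType) (G : sgraph) : R :=
  sup [set a : R | eigenvalue (adjacency_mx R G) a]%classic.

(* Main.v *)
Require Import Defs.
From HB Require Import structures.
From mathcomp Require Import all_boot all_order all_algebra.
From mathcomp Require Import boolp classical_sets reals.
From mathcomp Require Import fintype finset zify ring lra.
Import Order.TTheory GRing.Theory Num.Theory.
Set Implicit Arguments.
Unset Strict Implicit.
Unset Printing Implicit Defensive.
Local Open Scope ring_scope.

(** Rescale the absolute value [x] of an eigenvector so that its largest entry
    is [x u = 1]; then [A x >= rho x] entrywise.  Expand [(A^2 - (k-1) A) x] at
    [u] over the neighbourhood [N] of [u], the remaining vertices [W], the set
    [L] of vertices with at least [2k-1] neighbours inside [N], and [I = N \ L].
    Since [N] spans no matching of size [k], choosing partners greedily for the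
    vertices of [L] gives [#|L| <= k-1], and [I] spans no matching of size
    [k - #|L|], hence few edges.  It follows that [rho^2 - (k-1) rho] is at most
    [m - k(k-1)/2] minus a sum of nonnegative slacks, as soon as
    [rho > 5(k-1)].  The bound is the positive root of this quadratic, and in
    the equality case the vanishing of every slack forces [u |: L] to be a
    clique of size [k] joined to the independent set [I], all other vertices
    being isolated.  Working with a subeigenvector avoids Perron-Frobenius. *)

(** * Matchings inside a vertex set, degree sums and the handshake identity *)

Section Matchings.
Variable G : sgraph.
Implicit Types (X Y Z : {set G}) (u v w : G) (s : seq (G * G)).

Definition nbr X v : {set G} := [set w in X | adj v w].

(** A list of oriented edges; concatenating all first and all second endpoints makes disjointness a
    single [uniq]. *)
Definition matching X s : bool :=
  all (fun p => [&& p.1 \in X, p.2 \in X & adj p.1 p.2]) s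
  && uniq (unzip1 s ++ unzip2 s).

(** Each matching edge inside the neighbourhood of [u] closes a triangle with [u], and these
    triangles meet only in [u]. *)
Lemma friendship_of_matching u s :
  matching (nbr [set: G] u) s ->
  contains_subgraph G (friendship_graph (size s)).
Proof.
case/andP=> /allP sN us.
pose q := unzip1 s ++ unzip2 s.
(* Position in [q] of the image of [Some p]; injectivity of the embedding then comes from
   [uniq q]. *)
pose idx (p : 'I_(size s) * bool) := (if p.2 then size s + p.1 else p.1)%N.
have idx_lt p : (idx p < size q)%N.
  rewrite /q size_cat !size_map /idx; case: p => i [] /=; have := ltn_ord i; lia.
have nth_idx (p : 'I_(size s) * bool) : nth u q (idx p) =
    (if p.2 then (nth (u, u) s p.1).2 else (nth (u, u) s p.1).1).
  rewrite /q nth_cat !size_map /idx; case: p => i [] /=.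
    by rewrite ltnNge leq_addr /= addKn (nth_map (u, u)).
  by rewrite ltn_ord (nth_map (u, u)).
have memN (p : 'I_(size s) * bool) : adj u (nth u q (idx p)).
  have /sN := mem_nth (u, u) (ltn_ord p.1).
  by rewrite nth_idx !inE /= => /and3P[h1 h2 _]; case: p.2.
exists (fun o => if o is Some p then nth u q (idx p) else u); split.
- move=> [p|] [p'|] // h.
  + congr Some; move/eqP: h; rewrite nth_uniq //.
    case: p p' => [i b] [j c]; rewrite /idx /= => /eqP.
    have := ltn_ord i; have := ltn_ord j.
    case: b; case: c => hj hi e; congr pair; try (apply: val_inj => /=); lia.
  + by have := memN p; rewrite h adj_irrefl.
  + by have := memN p'; rewrite -h adj_irrefl.
- move=> [p|] [p'|] //=; last by rewrite adj_sym.
  case: p p' => [i b] [j c] /= /andP[/eqP <- bc].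
  have /sN := mem_nth (u, u) (ltn_ord i) => /and3P[_ _ h].
  by rewrite !nth_idx /=; case: b c bc => [] [] //= _; rewrite adj_sym.
Qed.

Lemma matching_cons X s v w :
  matching X s -> v \in X -> w \in X -> adj v w ->
  v \notin unzip1 s ++ unzip2 s -> w \notin unzip1 s ++ unzip2 s ->
  matching X ((v, w) :: s).
Proof.
case/andP=> sX us vX wX vw vs ws.
rewrite /matching.
rewrite (perm_uniq (permEl (perm_catCA (unzip1 _) [:: w] (unzip2 s)))) /=.
rewrite vX wX vw sX /=.
rewrite us vs inE negb_or ws !andbT eq_sym.
by apply: contraTneq vw => ->; rewrite adj_irrefl.
Qed.

Lemma matching_sub X Y s : X \subset Y -> matching X s -> matching Y s.
Proof.
move=> /subsetP XY /andP[/allP sX us]; rewrite /matching us andbT.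
by apply/allP=> p /sX /and3P[/XY -> /XY -> ->].
Qed.

Lemma matching_take X s n : matching X s -> matching X (take n s).
Proof.
case/andP=> /allP sX us; apply/andP; split.
  by apply/allP=> p /mem_take; apply: sX.
rewrite /unzip1 /unzip2 !map_take.
by apply: subseq_uniq us; apply: cat_subseq; apply: take_subseq.
Qed.

Lemma mem_matching X s v : matching X s -> v \in unzip1 s ++ unzip2 s -> v \in X.
Proof.
case/andP=> /allP sX _; rewrite mem_cat => /orP[] /mapP[p /sX /and3P[h1 h2 _] ->] //.
Qed.

(* Greedy: a vertex with [2k-1] neighbours always has one avoiding the at most
   [2k-2] vertices already in use. *)
Lemma matching_extend X k s (l : seq G) :
  matching X s -> uniq l -> {subset l <= X} ->
  (forall v, v \in l -> v \notin unzip1 s ++ unzip2 s) ->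
  (forall v, v \in l -> (2 * k - 1 <= #|nbr X v|)%N) ->
  (size s + size l <= k)%N ->
  exists2 s', matching X s' & size s' = (size s + size l)%N.
Proof.
elim: l s => [|v l IH] s sX; first by move=> *; exists s; rewrite ?addn0.
move=> /= /andP[vl ul] lX ls dl sz.
have [w wN wn] : exists2 w, w \in nbr X v & w \notin l ++ unzip1 s ++ unzip2 s.
  apply/subsetPn; apply/negP => /subset_leq_card h.
  have := leq_trans (dl v (mem_head _ _)) (leq_trans h (card_size _)).
  rewrite !size_cat !size_map; lia.
move: wN; rewrite inE => /andP[wX vw].
move: wn; rewrite mem_cat negb_or => /andP[wl ws].
have [||||||s' s'X s'sz] := IH ((v, w) :: s) => //=.
- apply: matching_cons => //; [exact/lX/mem_head|exact/ls/mem_head].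
- by move=> z zl; apply: lX; rewrite inE zl orbT.
- move=> z zl; rewrite inE mem_cat inE negb_or negb_or negb_or.
  have := ls z; rewrite inE zl orbT mem_cat negb_or => /(_ isT) /andP[-> ->] /=.
  rewrite andbT; apply/andP; split; first by apply: contraNneq vl => <-.
  by apply: contraNneq wl => <-.
- by move=> z zl; apply: dl; rewrite inE zl orbT.
- by rewrite addSn -addnS.
- by exists s' => //; rewrite s'sz /= addSn addnS.
Qed.

(** Deleting both ends of an edge lowers the degree sum by at most [4D]. Either this can be done
    [b+1] times, giving a matching, or no edge is left after at most [b] deletions. *)
Lemma degree_sum_matching X b D :
  (forall v, v \in X -> (#|nbr X v| <= D)%N) ->
  (exists2 s, matching X s & size s = b.+1) \/
  (\sum_(v in X) #|nbr X v| <= 4 * b * D)%N.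
Proof.
(* The degree of [p] is lost twice: as its own summand and as one unit at each of its neighbours. *)
have rem1 Y p : p \in Y ->
    (\sum_(v in Y) #|nbr Y v| =
     \sum_(v in Y :\ p) #|nbr (Y :\ p) v| + 2 * #|nbr Y p|)%N.
  move=> pY; rewrite (big_setD1 p) //=.
  have -> : (\sum_(v in Y :\ p) #|nbr Y v| =
     \sum_(v in Y :\ p) (#|nbr (Y :\ p) v| + adj p v))%N.
    apply: eq_bigr => v _; rewrite (cardsD1 p (nbr Y v)) addnC inE pY /= adj_sym.
    by congr (_ + _)%N; apply: eq_card => w; rewrite !inE andbA.
  rewrite big_split /=.
  have -> : (\sum_(v in Y :\ p) adj p v = #|nbr Y p|)%N.
    rewrite -sum1_card big_mkcond [RHS]big_mkcond /=; apply: eq_bigr => v _.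
    rewrite !inE; case: eqVneq => [->|_] /=; first by rewrite adj_irrefl andbF.
    by case: (v \in Y); case: adj.
  lia.
have nbrS Y Z v : Y \subset Z -> (#|nbr Y v| <= #|nbr Z v|)%N.
  move=> /subsetP YZ; apply: subset_leq_card; apply/subsetP=> w.
  by rewrite !inE => /andP[/YZ -> ->].
have edge Y : (exists p q, [/\ p \in Y, q \in Y & adj p q]) \/
    (\sum_(v in Y) #|nbr Y v| = 0)%N.
  have [/pred0P h|/pred0Pn[[p q] /= /and3P[*]]] :=
      boolP (pred0b (fun p : G * G => [&& p.1 \in Y, p.2 \in Y & adj p.1 p.2])).
    right; rewrite big1 // => v vY; apply/eqP; rewrite cards_eq0.
    apply/set0Pn => -[w]; rewrite inE => /andP[wY vw].
    by have := h (v, w); rewrite /= vY wY vw.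
  by left; exists p, q.
elim: b X => [|b IH] X hD;
  have [[p [q [pX qX pq]]]|e] := edge X; try by right; rewrite e.
  by left; exists [:: (p, q)] => //; apply: matching_cons.
have XS : X :\ p :\ q \subset X by apply: subset_trans (subD1set _ _) (subD1set _ _).
have pq' : q != p by apply: contraTneq pq => ->; rewrite adj_irrefl.
case: (IH (X :\ p :\ q)).
- move=> v vX; apply: leq_trans (nbrS _ _ v XS) _.
  by apply: hD; apply: (subsetP XS).
- move=> [s sX sz]; left; exists ((p, q) :: s); last by rewrite /= sz.
  apply: matching_cons => //; first exact: matching_sub sX.
    by apply/negP => /(mem_matching sX); rewrite !inE eqxx andbF.
  by apply/negP => /(mem_matching sX); rewrite !inE eqxx.
- move=> le; right; rewrite (rem1 _ _ pX) (rem1 (X :\ p) q) ?inE ?pq' ?qX //.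
  have := hD p pX; have := leq_trans (nbrS _ _ q (subD1set X p)) (hD q qX).
  lia.
Qed.

(** Adjacent ordered pairs are grouped by the edge they span; each fibre is [{(a, b), (b, a)}] with
    [a != b]. *)
Lemma handshake : (\sum_(v : G) \sum_(w : G) adj v w = 2 * #|edges G|)%N.
Proof.
rewrite pair_big /=.
have -> : (\sum_(p : G * G) adj p.1 p.2 = \sum_(p in [set p : G * G | adj p.1 p.2]) 1)%N.
  rewrite [RHS]big_mkcond /=; apply: eq_bigr => p _; rewrite inE.
  by case: adj.
rewrite (partition_big_imset (fun p : G * G => [set p.1; p.2])) /=.
have eqE : [set [set p.1; p.2] | p in [set p : G * G | adj p.1 p.2]] = edges G.
  by apply/setP => e; apply/imsetP/imsetP => -[p hp ->]; exists p; rewrite ?inE in hp *.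
rewrite eqE mulnC -sum_nat_const; apply: eq_bigr => e /imsetP[[a b]].
rewrite inE /= => ab ->.
have nab : a != b by apply: contraTneq ab => ->; rewrite adj_irrefl.
have <- : #|[set (a, b); (b, a)]| = 2%N.
  by rewrite cards2 xpair_eqE (negbTE nab).
rewrite sum1dep_card; apply: eq_card => -[c d]; rewrite !inE /= !xpair_eqE.
apply/andP/orP => [[cd /eqP/setP cdE]|[] /andP[/eqP-> /eqP->]]; last first.
- by rewrite adj_sym setUC.
- by rewrite ab.
have ncd : c != d by apply: contraTneq cd => ->; rewrite adj_irrefl.
have := cdE c; have := cdE d; rewrite !inE !eqxx orbT /=.
move=> /esym/orP[]/eqP dE /esym/orP[]/eqP cE; subst; rewrite ?eqxx //= in ncd *; by [left|right].
Qed.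

End Matchings.

Lemma sumr_eq0_imp (R : numDomainType) (T : finType) (P : pred T) (F : T -> R) :
  (forall v, P v -> 0 <= F v) -> \sum_(v | P v) F v = 0 ->
  forall v, P v -> F v = 0.
Proof.
move=> F0 /eqP; rewrite psumr_eq0 // => /allP h v Pv; apply/eqP.
by move: (h v (mem_index_enum v)); rewrite Pv.
Qed.

(** * Counting around the vertex [u] that carries the largest entry *)

Section LocalStructure.
Variables (R : realFieldType) (G : sgraph) (k : nat) (u : G).
Hypothesis k2 : (2 <= k)%N.
Hypothesis free : ~ contains_subgraph G (friendship_graph k).

Local Notation a v w := ((adj v w)%:R : R).
Let N : {set G} := nbr [set: G] u.
Let W : {set G} := [set v | (v != u) && ~~ adj u v].
Let L : {set G} := [set v in N | (2 * k - 1 <= #|nbr N v|)%N].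
Let I : {set G} := N :\: L.
Let d (X : {set G}) v : R := \sum_(w in X) a v w.

Let inN v : (v \in N) = adj u v. Proof. by rewrite !inE. Qed.

Let splitU (F : G -> R) :
  \sum_v F v = F u + \sum_(v in N) F v + \sum_(v in W) F v.
Proof.
rewrite (bigD1 u) //= -addrA; congr (_ + _).
rewrite (bigID (adj u)) /=; congr (_ + _); apply: eq_bigl => v; rewrite !inE //=.
by case: eqVneq => [->|] //=; rewrite adj_irrefl.
Qed.

Let LN : L \subset N. Proof. by apply/subsetP => v; rewrite inE => /andP[]. Qed.

Let splitN (F : G -> R) :
  \sum_(v in N) F v = \sum_(v in L) F v + \sum_(v in I) F v.
Proof. by rewrite (big_setID L) /= (setIidPr LN). Qed.

Let dE X v : d X v = #|nbr X v|%:R.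
Proof.
rewrite /d -sum1_card natr_sum [LHS]big_mkcond [RHS]big_mkcond /=.
apply: eq_bigr => w _; rewrite inE.
by case: (w \in X); case: adj.
Qed.

(** [M] avoids [L], so [matching_extend] adds one edge per vertex of [L]; [k] disjoint edges inside
    [N] would form a friendship graph with centre [u]. *)
Lemma matching_size_lt M : matching I M -> (size M + #|L| < k)%N.
Proof.
move=> mM; rewrite ltnNge; apply/negP => le.
(* [L] is cut to at most [k] vertices and [M] to the number still missing, so that exactly [k] edges
   result. *)
pose l := take k (enum L).
have lL v : v \in l -> v \in L by move=> /mem_take; rewrite mem_enum.
have szl : (size l = minn k #|L|)%N by rewrite size_take_min cardE.
have IN : I \subset N by apply: subsetDl.
pose s := take (k - size l) M.
have mI : matching I s by apply: matching_take.
have [||||||s' ms' szs'] := @matching_extend G N k s l.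
- exact: matching_sub mI.
- by rewrite take_uniq ?enum_uniq.
- by move=> v /lL; apply: (subsetP LN).
- move=> v /lL vL; apply/negP => /(mem_matching mI).
  by rewrite inE vL.
- by move=> v /lL; rewrite inE => /andP[].
- rewrite /s size_take_min szl; lia.
have sz : size s' = k by rewrite szs' /s size_take_min szl; lia.
by apply: free; rewrite -sz; apply: friendship_of_matching ms'.
Qed.

Lemma card_high_degree : (#|L| < k)%N.
Proof. by have := @matching_size_lt [::] isT. Qed.

(** This is [degree_sum_matching] with [b = k-1-#|L|] and [D = 2(k-1)]: a matching of size [b+1] in
    [I] is excluded by [matching_size_lt], and outside [L] degrees in [N] are at most [2k-2]. *)
Lemma degree_sum_low_degree : \sum_(v in I) d I v <= 8 * (k%:R - 1 - #|L|%:R) * (k%:R - 1).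
Proof.
have [||] := @degree_sum_matching G I (k - 1 - #|L|) (2 * (k - 1)).
- move=> v; rewrite in_setD => /andP[+ vN]; rewrite inE vN /= -ltnNge => nd.
  apply: (@leq_trans #|nbr N v|); last lia.
  by apply: subset_leq_card; apply/subsetP => w; rewrite !inE => /andP[/andP[_ ->] ->].
- by move=> [M /matching_size_lt]; lia.
- move=> le; under eq_bigr do rewrite dE.
  have -> : k%:R - 1 - #|L|%:R = (k - 1 - #|L|)%N%:R :> R.
    by rewrite -subnDA natrB ?natrD ?opprD ?addrA // add1n card_high_degree.
  have -> : k%:R - 1 = (k - 1)%N%:R :> R by rewrite natrB // ltnW.
  by rewrite -natr_sum -!natrM ler_nat; lia.
Qed.

Variables (x : G -> R) (rho : R).
Hypothesis x_ge0 : forall v, 0 <= x v.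
Hypothesis x_le1 : forall v, x v <= 1.
Hypothesis xu : x u = 1.
Hypothesis sub : forall v, rho * x v <= \sum_w a v w * x w.
Hypothesis rho_gt : 5 * (k%:R - 1) < rho.

Let m : R := #|edges G|%:R.
Let Ax v : R := \sum_w a v w * x w.

Let sumN (F : G -> R) : \sum_w a u w * F w = \sum_(w in N) F w.
Proof.
rewrite [RHS]big_mkcond /=; apply: eq_bigr => w _; rewrite inN.
by case: adj; rewrite ?mul1r ?mul0r.
Qed.

(* The part of the slack that is not nonnegative termwise; in the extremal
   graph it equals [k(k-1)/2]. *)
Let Q : R := #|L|%:R * (k%:R - 1) - (\sum_(v in L) d L v) / 2
  + (\sum_(v in I) d I v) / 2 + \sum_(v in I) (k%:R - 1 - d N v) * x v.

(** The bracket on the left is [(A^2 - (k-1) A) x] at [u]. Both it and [2m], counted as adjacent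
    ordered pairs, are split along [u], [L], [I] and [W]; the rest is linear algebra in these
    partial sums. *)
Lemma slack_identity :
  m - (\sum_(v in N) Ax v - (k%:R - 1) * Ax u) =
  \sum_(v in N) \sum_(w in W) a v w * (1 - x w)
  + (\sum_(v in W) d W v) / 2
  + \sum_(v in L) (d N v - (k%:R - 1)) * (1 - x v) + Q.
Proof.
have hs : 2 * m = \sum_(v : G) \sum_(w : G) a v w.
  by rewrite -natrM -handshake natr_sum; apply: eq_bigr => v _; rewrite natr_sum.
have symS (X Y : {set G}) : \sum_(v in X) d Y v = \sum_(v in Y) d X v.
  rewrite exchange_big /=; apply: eq_bigr => w _; apply: eq_bigr => v _.
  by rewrite adj_sym.
have Nu v : v \in N -> a v u = 1 by rewrite inN adj_sym => ->.
have Wu v : v \in W -> a v u = 0 by rewrite inE adj_sym => /andP[_ /negbTE ->].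
have e1 : \sum_(v : G) \sum_(w : G) a v w =
    2 * \sum_(v in N) a v u + \sum_(v in N) d N v + 2 * \sum_(v in N) d W v
    + \sum_(v in W) d W v.
  rewrite (eq_bigr _ (fun v _ => splitU (fun w => a v w))) splitU !big_split /=.
  rewrite adj_irrefl.
  rewrite [\sum_(v in W) a v u]big1; last by move=> v /Wu.
  rewrite [\sum_(v in W) a u v]big1; last by move=> v; rewrite adj_sym; apply: Wu.
  have -> : \sum_(v in N) a u v = \sum_(v in N) a v u.
    by apply: eq_bigr => v _; rewrite adj_sym.
  move: (symS W N); rewrite /d /= => ->; ring.
have e2 : \sum_(v in N) Ax v = \sum_(v in N) a v u + \sum_(v in N) d N v * x v
    + \sum_(v in N) \sum_(w in W) a v w * x w.
  under eq_bigr do rewrite /Ax splitU xu mulr1.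
  rewrite !big_split /=; congr (_ + _ + _).
  rewrite exchange_big /=; apply: eq_bigr => w _; rewrite /d mulr_suml.
  by apply: eq_bigr => v _; rewrite adj_sym.
have e3 : \sum_(v in N) \sum_(w in W) a v w * (1 - x w) =
    \sum_(v in N) d W v - \sum_(v in N) \sum_(w in W) a v w * x w.
  rewrite -sumrB; apply: eq_bigr => v _; rewrite -sumrB.
  by apply: eq_bigr => w _; rewrite mulrBr mulr1.
have e4 : Ax u = \sum_(v in L) x v + \sum_(v in I) x v by rewrite /Ax sumN splitN.
have e5 : \sum_(v in L) (d N v - (k%:R - 1)) * (1 - x v) =
   \sum_(v in L) d N v - #|L|%:R * (k%:R - 1) - \sum_(v in L) d N v * x v
   + (k%:R - 1) * \sum_(v in L) x v.
  rewrite mulr_sumr -[#|L|]sum1_card natr_sum mulr_suml -!sumrB -big_split /=.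
  by apply: eq_bigr => v _; ring.
have e6 : \sum_(v in I) (k%:R - 1 - d N v) * x v =
   (k%:R - 1) * \sum_(v in I) x v - \sum_(v in I) d N v * x v.
  by rewrite mulr_sumr -sumrB; apply: eq_bigr => v _; ring.
have e7 : \sum_(v in N) d N v =
   \sum_(v in L) d L v + 2 * \sum_(v in L) d I v + \sum_(v in I) d I v.
  rewrite (eq_bigr _ (fun v _ => splitN (fun w => a v w))) splitN.
  rewrite !big_split /=; move: (symS I L); rewrite /d /= => ->; ring.
have e8 : \sum_(v in L) d N v = \sum_(v in L) d L v + \sum_(v in L) d I v.
  by under eq_bigr do rewrite /d splitN; rewrite big_split.
have e9 : \sum_(v in N) d N v * x v =
   \sum_(v in L) d N v * x v + \sum_(v in I) d N v * x v by rewrite splitN.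
rewrite /Q e2 e3 e4 e5 e6 e9.
have : 2 * m = 2 * \sum_(v in N) a v u + \sum_(v in N) d N v
    + 2 * \sum_(v in N) d W v + \sum_(v in W) d W v by rewrite hs e1.
rewrite e7 e8; move: (\sum_(v in N) d W v) => z1.
move: (\sum_(v in W) d W v) (\sum_(v in L) d L v) (\sum_(v in I) d I v) => z2 z3 z4.
lra.
Qed.

Let s : R := #|L|%:R.
Let kR1 : 1 <= k%:R - 1 :> R.
Proof. by rewrite lerBrDr; have : 2%:R <= k%:R :> R by rewrite ler_nat. Qed.

Let s_le : s <= k%:R - 1.
Proof. by rewrite lerBrDr /s natr1 ler_nat card_high_degree. Qed.

Let a_le1 (v w : G) : a v w <= 1. Proof. by rewrite lern1; case: adj. Qed.

Let d_le X v : d X v <= #|X|%:R.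
Proof. by rewrite /d -sum1_card natr_sum; apply: ler_sum => w _. Qed.

Let dL_le v : v \in L -> d L v <= s - 1.
Proof.
move=> vL; rewrite /d (big_setD1 v) //= adj_irrefl add0r.
apply: le_trans (d_le (L :\ v) v) _.
by rewrite /s (cardsD1 v L) vL add1n -natr1 addrK.
Qed.

Let sumLL_le : \sum_(v in L) d L v <= s * (s - 1).
Proof. by rewrite mulr_natl -sumr_const; apply: ler_sum. Qed.

Let Ax_u_ge : rho <= Ax u. Proof. by have := sub u; rewrite xu mulr1. Qed.

(** With [b = k-1-s], the last sum of [Q] is at least [b (rho - s)] minus the degree sum of [I].
    Half of that degree sum remains to be paid, at most [4b(k-1)], which [rho > 5(k-1)] covers with
    more than [b(k-1)] to spare. *)
Lemma core_slack_lt : s < k%:R - 1 -> k%:R * (k%:R - 1) / 2 < Q.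
Proof.
move=> slt; pose b : R := k%:R - 1 - s.
have b0 : 0 < b by rewrite /b; lra.
have b1 : 0 <= s by apply: ler0n.
have h1 : \sum_(v in I) (k%:R - 1 - d N v) * x v >= b * \sum_(v in I) x v - \sum_(v in I) d I v.
  rewrite mulr_sumr -sumrB; apply: ler_sum => v _.
  have -> : d N v = d L v + d I v by rewrite /d splitN.
  have h0 : 0 <= d I v by apply: sumr_ge0.
  have := d_le L v; rewrite -/s /b; have := x_ge0 v; have := x_le1 v; nra.
have h2 : \sum_(v in I) x v >= rho - s.
  have := Ax_u_ge; rewrite /Ax sumN splitN.
  suff : \sum_(v in L) x v <= s by lra.
  by rewrite /s -sum1_card natr_sum; apply: ler_sum.
have h3 := degree_sum_low_degree; rewrite -/s -/b in h3.
have h4 := sumLL_le.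
have h5 : b * (rho - s) <= b * \sum_(v in I) x v by rewrite ler_pM2l.
have h6 : b * (5 * (k%:R - 1)) < b * rho by rewrite ltr_pM2l.
(* Integrality of [#|L|]: the estimate for [Q] exceeds [k(k-1)/2] by more than [b(b-1)/2], which
   must not be negative. *)
have b_ge1 : 1 <= b.
  move: slt; rewrite ltrBrDr /b /s natr1 ltr_nat => slt.
  by have : (#|L|.+2)%:R <= k%:R :> R by [rewrite ler_nat]; rewrite -!natr1; lra.
have h7 : 0 <= b * (b - 1) by rewrite mulr_ge0; lra.
have kE : k%:R = s + b + 1 by rewrite /b; ring.
rewrite /Q -/s kE in h1 h3 h6 *; move: h1 h3 h4 h5 h6 h7.
move: (\sum_(v in I) x v) (\sum_(v in I) d I v) (\sum_(v in L) d L v).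
by move=> z1 z2 z3 h1 *; lra.
Qed.

(** The hypothesis is the reverse of the inequality given by [slack_identity]. A set [L] with fewer
    than [k-1] vertices would make that inequality strict; otherwise all slacks vanish and the graph
    can be read off with [C = u |: L] and [J = I]. *)
Lemma local_structure :
  m - k%:R * (k%:R - 1) / 2 <= rho ^+ 2 - (k%:R - 1) * rho ->
  rho ^+ 2 - (k%:R - 1) * rho = m - k%:R * (k%:R - 1) / 2 /\
  exists C J : {set G}, [/\ [disjoint C & J], #|C| = k &
    forall p q, adj p q = (p != q) &&
      [|| (p \in C) && (q \in C), (p \in C) && (q \in J)
        | (p \in J) && (q \in C)]].
Proof.
move=> hm.
have z0 v : 0 <= Ax v - rho * x v by rewrite subr_ge0 sub.
have Ax_u : Ax u = \sum_(v in N) x v by rewrite /Ax sumN.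
have zsum : \sum_(v in N) Ax v = \sum_(v in N) (Ax v - rho * x v) + rho * Ax u.
  by rewrite Ax_u mulr_sumr -big_split /=; apply: eq_bigr => v _; ring.
have Z0 : 0 <= \sum_(v in N) (Ax v - rho * x v) by apply: sumr_ge0.
have ax0 (v w : G) : 0 <= a v w * (1 - x w) by rewrite mulr_ge0 ?ler0n ?subr_ge0.
have P1ge : 0 <= \sum_(v in N) \sum_(w in W) a v w * (1 - x w).
  by apply: sumr_ge0 => v _; apply: sumr_ge0.
have dge X v : 0 <= d X v by apply: sumr_ge0.
have P2ge : 0 <= \sum_(v in W) d W v by apply: sumr_ge0.
have dNL v : v \in L -> k%:R - 1 < d N v.
  rewrite inE => /andP[_ h]; rewrite dE -(ler_nat R) in h *; move: h.
  by rewrite natrB ?natrM; [have := kR1; lra|rewrite muln_gt0 (ltnW k2)].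
have p3 v : v \in L -> 0 <= (d N v - (k%:R - 1)) * (1 - x v).
  by move=> /dNL h; rewrite mulr_ge0 ?subr_ge0 // ltW.
have P3ge : 0 <= \sum_(v in L) (d N v - (k%:R - 1)) * (1 - x v) by apply: sumr_ge0.
have slack := slack_identity.
(* After [Ax v >= rho * x v] is summed over [N], this replaces the remaining factor [Ax u] by
   [rho]. *)
have zu : 0 <= (rho - (k%:R - 1)) * (Ax u - rho).
  by rewrite mulr_ge0 // ?subr_ge0 //; have := kR1; have := rho_gt; lra.
have [slt|sge] := ltP s (k%:R - 1).
  exfalso; have := core_slack_lt slt; move: Z0 P1ge P2ge P3ge zu slack hm zsum.
  rewrite expr2.
  move: (\sum_(v in N) (Ax v - rho * x v)) (\sum_(v in W) d W v)
   (\sum_(v in N) \sum_(w in W) a v w * (1 - x w))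
   (\sum_(v in L) (d N v - (k%:R - 1)) * (1 - x v)) (\sum_(v in N) Ax v) (Ax u) k%:R.
  move=> y1 y2 y3 y4 y5 y6 K *; lra.
have sE : s = k%:R - 1 by apply/eqP; rewrite eq_le s_le sge.
have cL : #|L|.+1 = k by apply/eqP; rewrite -(eqr_nat R) -natr1 -/s sE subrK.
(* For [#|L| = k-1] the bound of [degree_sum_low_degree] is zero, so [I] is independent. *)
have SII0 : \sum_(v in I) d I v = 0.
  apply/eqP; rewrite eq_le sumr_ge0 // andbT.
  by have := degree_sum_low_degree; rewrite -/s sE subrr mulr0 mul0r.
have dI0 v : v \in I -> d I v = 0 by apply: (sumr_eq0_imp _ SII0).
have dNI v : d N v = d L v + d I v by rewrite /d splitN.
have q4 v : v \in I -> 0 <= (k%:R - 1 - d N v) * x v.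
  move=> vI; rewrite mulr_ge0 // subr_ge0 dNI dI0 // addr0 -sE; exact: d_le.
have Q4ge : 0 <= \sum_(v in I) (k%:R - 1 - d N v) * x v by apply: sumr_ge0.
have LLge := sumLL_le.
(* Here [Q] is at least [s^2 - s(s-1)/2 = k(k-1)/2], so the chain of inequalities closes up and each
   of its terms is tight. *)
have [e0 [eZ eu] [e1 e2 e3] [eL eI]] : [/\
  rho ^+ 2 - (k%:R - 1) * rho = m - k%:R * (k%:R - 1) / 2,
  \sum_(v in N) (Ax v - rho * x v) = 0 /\ (rho - (k%:R - 1)) * (Ax u - rho) = 0,
  [/\ \sum_(v in N) \sum_(w in W) a v w * (1 - x w) = 0,
      \sum_(v in W) d W v = 0 &
      \sum_(v in L) (d N v - (k%:R - 1)) * (1 - x v) = 0] &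
  \sum_(v in L) d L v = s * (s - 1) /\
  \sum_(v in I) (k%:R - 1 - d N v) * x v = 0].
  move: slack Z0 P1ge P2ge P3ge zu hm zsum Q4ge LLge.
  rewrite /Q -/s SII0 sE expr2.
  move: (\sum_(v in N) (Ax v - rho * x v)) (\sum_(v in W) d W v) (\sum_(v in L) d L v)
   (\sum_(v in N) \sum_(w in W) a v w * (1 - x w))
   (\sum_(v in L) (d N v - (k%:R - 1)) * (1 - x v))
   (\sum_(v in I) (k%:R - 1 - d N v) * x v) (\sum_(v in N) Ax v) (Ax u) k%:R.
  move=> y1 y2 y3 y4 y5 y6 y7 y8 K *.
  by split; [|split|split|split]; lra.
split=> //.
have Au : Ax u = rho.
  move/eqP: eu; rewrite mulf_eq0 => /orP[]/eqP; last by lra.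
  by have := kR1; have := rho_gt; lra.
have zN v : v \in N -> Ax v = rho * x v.
  by move=> vN; apply/eqP; rewrite -subr_eq0; apply/eqP/(sumr_eq0_imp _ eZ).
have rho0 : 0 < rho by have := kR1; have := rho_gt; lra.
(* Each such [v] sees [u], whose entry is 1; positivity allows [x v] to be cancelled from vanishing
   slacks. *)
have xN v : v \in N -> 0 < x v.
  move=> vN; rewrite -(pmulr_rgt0 _ rho0) -zN // /Ax (bigD1 u) //= xu mulr1.
  rewrite adj_sym -inN vN ltr_pwDl ?ltr01 ?sumr_ge0 // => w _.
  by rewrite mulr_ge0.
have xL v : v \in L -> x v = 1.
  move=> vL; have /eqP := sumr_eq0_imp p3 e3 vL; rewrite mulf_eq0 => /orP[]/eqP.
    by have := dNL v vL; lra.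
  by lra.
have nbrL v : nbr L v \subset L by apply/subsetP => w; rewrite inE => /andP[].
have LI v w : v \in I -> w \in L -> adj v w.
  move=> vI wL; have vN : v \in N by move: vI; rewrite in_setD => /andP[].
  have /eqP := sumr_eq0_imp q4 eI vI; rewrite mulf_eq0 (gt_eqF (xN v vN)) orbF.
  rewrite subr_eq0 dNI dI0 // addr0 -sE dE eqr_nat => /eqP e.
  have /eqP : nbr L v == L by rewrite eqEcard nbrL e /=.
  by move/setP/(_ w); rewrite inE wL /=.
have II v w : v \in I -> w \in I -> adj v w = false.
  move=> vI wI; move/eqP: (dI0 v vI); rewrite dE pnatr_eq0 cards_eq0 => /eqP/setP/(_ w).
  by rewrite !inE in wI *; rewrite wI.
have LL v w : v \in L -> w \in L -> v != w -> adj v w.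
  move=> vL wL vw.
  have dLv t : t \in L -> 0 <= s - 1 - d L t.
    by move=> tL; rewrite subr_ge0 dL_le.
  have : \sum_(t in L) (s - 1 - d L t) = 0.
    by rewrite sumrB eL sumr_const -[_ *+ _]mulr_natl subrr.
  move=> /(sumr_eq0_imp dLv)/(_ v vL) e.
  have cE : #|nbr L v| = #|L :\ v|.
    apply/eqP; rewrite -(eqr_nat R) -dE; move: e.
    by rewrite /s (cardsD1 v L) vL add1n -natr1 addrK => /eqP; rewrite subr_eq0 eq_sym.
  have /eqP : nbr L v == L :\ v.
    rewrite eqEcard cE leqnn andbT; apply/subsetP => t; rewrite in_setD1 inE => /andP[-> vt].
    by rewrite andbT; apply: contraTneq vt => ->; rewrite adj_irrefl.
  by move/setP/(_ w); rewrite in_setD1 inE wL eq_sym vw.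
have [v0 v0L] : exists v, v \in L by apply/set0Pn; rewrite -cards_eq0 -lt0n -ltnS cL.
(* A neighbour of [w] must lie in [N], and the slack between [N] and [W] then forces [x w = 1]. So
   [Ax w >= rho = Ax u], which makes [w] adjacent to all of [N]. *)
have W0 w y : w \in W -> adj w y = false.
  move=> wW; apply/negP => wy.
  have WW t : t \in W -> adj w t = false.
    move=> tW; have : d W w = 0 by apply: (sumr_eq0_imp _ e2).
    move/eqP; rewrite dE pnatr_eq0 cards_eq0 => /eqP/setP/(_ t).
    by rewrite !inE in tW *; rewrite tW.
  have wu : adj w u = false by move: wW; rewrite inE adj_sym => /andP[_ /negbTE].
  have yN : y \in N.
    rewrite inN; apply: contraT => uy.
    have yu : y != u by apply: contraTneq wy => ->; rewrite wu.
    by move: wy; rewrite WW // inE yu uy.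
  have xw : x w = 1.
    have : \sum_(t in W) a y t * (1 - x t) = 0.
      by apply: (sumr_eq0_imp _ e1) yN => t _; apply: sumr_ge0.
    move=> /(sumr_eq0_imp (fun t _ => ax0 y t))/(_ w wW).
    by rewrite adj_sym wy mul1r; lra.
  have Aw : Ax w = \sum_(t in N) a w t * x t.
    rewrite /Ax splitU wu mul0r add0r [X in _ + X]big1 ?addr0 // => t tW.
    by rewrite WW // mul0r.
  have wN t : t \in N -> adj w t.
    move=> tN.
    have g0 r : r \in N -> 0 <= (1 - a w r) * x r by move=> _; rewrite mulr_ge0 ?subr_ge0.
    have : \sum_(r in N) (1 - a w r) * x r = 0.
      apply/eqP; rewrite eq_le sumr_ge0 ?andbT //.
      under eq_bigr do rewrite mulrBl mul1r.
      by rewrite sumrB -Aw -Ax_u Au subr_le0; have := sub w; rewrite xw mulr1.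
    move=> /(sumr_eq0_imp g0)/(_ t tN)/eqP; rewrite mulf_eq0 (gt_eqF (xN t tN)) orbF.
    by case: adj => //; rewrite subr0 oner_eq0.
  (* Contradiction at [v0]: it loses its own entry 1 from the sum over [N] but gains 1 from [u] and
     1 from [w], so [Ax v0] exceeds [Ax u = rho], although [Ax v0 = rho]. *)
  have v0N := subsetP LN _ v0L.
  have := zN v0 v0N; rewrite xL // mulr1 -Au Ax_u /Ax splitU xu mulr1.
  rewrite adj_sym -inN v0N 2!splitN.
  have -> : \sum_(t in I) a v0 t * x t = \sum_(t in I) x t.
    by apply: eq_bigr => t tI; rewrite adj_sym LI // mul1r.
  have -> : \sum_(t in L) a v0 t * x t = \sum_(t in L) x t - 1.
    rewrite (big_setD1 v0) //= adj_irrefl mul0r add0r [in RHS](big_setD1 v0) //= xL //.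
    rewrite addrAC subrr add0r; apply: eq_bigr => t; rewrite in_setD1 => /andP[tv tL].
    by rewrite LL ?mul1r // eq_sym.
  rewrite [\sum_(t in W) _](big_setD1 w) //= [adj v0 w]adj_sym wN // xw mulr1 mulr1n.
  have : 0 <= \sum_(t in W :\ w) a v0 t * x t by apply: sumr_ge0 => t _; rewrite mulr_ge0.
  lra.
have uL : u \notin L by rewrite inE inN adj_irrefl.
have uI : u \notin I by rewrite in_setD inN adj_irrefl andbF.
exists (u |: L), I; split.
- rewrite -setI_eq0; apply/eqP/setP => v; rewrite in_setI in_setU1 in_set0.
  apply/negP => /andP[/orP[/eqP->|vL]]; first exact/negP.
  by rewrite in_setD vL.
- by rewrite cardsU1 uL.
have cls p : [\/ p = u, p \in L, p \in I | p \in W].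
  case: (eqVneq p u) => [->|pu]; first by constructor 1.
  case pN: (p \in N); last by constructor 4; rewrite inE pu -inN pN.
  by case pL: (p \in L); [constructor 2|constructor 3; rewrite in_setD pL pN].
have Lcl p : p \in L -> (p == u = false) * (p \in I = false) * adj u p.
  move=> pL; rewrite in_setD pL -inN (subsetP LN) //.
  by split=> //; split=> //; apply: contraNF uL => /eqP <-.
have Icl p : p \in I -> (p == u = false) * (p \in L = false) * adj u p.
  move=> pI; move: (pI); rewrite in_setD => /andP[/negbTE-> pN]; rewrite -inN pN.
  by split=> //; split=> //; apply: contraNF uI => /eqP <-.
have Wcl p : p \in W -> (p == u = false) * (p \in L = false) * (p \in I = false).
  rewrite inE -inN => /andP[/negbTE-> pN]; split; first split=> //.
    by apply: contraNF pN; apply: (subsetP LN).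
  by apply: contraNF pN; rewrite in_setD => /andP[].
move=> p q; rewrite !in_setU1.
case: (cls p) => [->|pL|pI|pW]; last by rewrite W0 // !(Wcl p pW) !andbF.
all: case: (cls q) => [->|qL|qI|qW];
  try by rewrite adj_sym W0 // !(Wcl q qW) !andbF.
- by rewrite adj_irrefl eqxx.
- by rewrite eqxx qL eq_sym !(Lcl q qL) orbT.
- by rewrite eqxx qI eq_sym !(Icl q qI).
- by rewrite adj_sym eqxx pL !(Lcl p pL) orbT.
- case: (eqVneq p q) => [->|pq]; first by rewrite adj_irrefl.
  by rewrite LL // pL qL !orbT.
- rewrite adj_sym LI // pL qI !orbT /=; symmetry; apply/andP; split=> //.
  by apply: contraFneq (Icl q qI).1.2 => <-.
- by rewrite adj_sym eqxx pI !(Icl p pI).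
- rewrite LI // pI qL !orbT andbT; symmetry.
  by apply: contraFneq (Lcl q qL).1.2 => <-.
- by rewrite II // !(Icl q qI) !(Icl p pI) !andbF.
Qed.

End LocalStructure.

(** * The spectral radius as an eigenvalue, and eigenvectors as functions on vertices *)

(** An unattained supremum would yield arbitrarily many roots of [p]. *)
Lemma sup_root (R : realType) (p : {poly R}) (E : set R) :
  p != 0 -> (forall e, E e <-> root p e) -> has_sup E -> E (sup E).
Proof.
move=> p0 EP hs; apply: contrapT => nE.
have Elt e : E e -> e < sup E.
  move=> Ee; rewrite lt_neqAle (sup_upper_bound hs) // andbT.
  by apply/eqP => eE; apply: nE; rewrite -eE.
have step b : b < sup E -> exists2 e, E e & b < e.
  move=> blt; have [|e Ee lt] := @sup_adherent _ E (sup E - b) _ hs.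
    by rewrite subr_gt0.
  by exists e => //; move: lt; rewrite opprB addrCA subrr addr0.
(* The list stays below some [b] smaller than the supremum, so a root above [b] exists and is
   new. *)
have long n : exists l : seq R, [/\ size l = n, uniq l, all (root p) l &
    exists2 b, b < sup E & all (fun e => e <= b) l].
  elim: n => [|n [l [sz ul rl [b blt lb]]]].
    by exists [::]; split=> //; exists (sup E - 1) => //; rewrite ltrBlDr ltrDl ltr01.
  have [e Ee be] := step b blt.
  exists (e :: l); split=> //=; first by rewrite sz.
  - rewrite ul andbT; apply/negP => /(allP lb); by rewrite leNgt be.
  - by rewrite rl andbT; apply/EP.
  - exists e; first exact: Elt.
    rewrite lexx /=; apply/allP => z /(allP lb) zb; exact: le_trans zb (ltW be).
have [l [sz ul rl _]] := long (size p).
by have := max_poly_roots p0 rl ul; rewrite sz ltnn.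
Qed.

Section Spectrum.
Variables (R : realType) (G : sgraph).
Local Notation a v w := ((adj v w)%:R : R).

Lemma eigenvalue_adjacencyP (b : R) :
  eigenvalue (adjacency_mx R G) b <->
  exists2 y : G -> R, (exists v, y v != 0) &
    forall v, \sum_w a v w * y w = b * y v.
Proof.
have re (F : G -> R) : \sum_v F v = \sum_(i < #|G|) F (enum_val i).
  by rewrite (reindex (@enum_val _ (mem G))) //; apply: onW_bij; apply: enum_val_bij.
split=> [/eigenvalueP[y yA y0]|[y [v0 yv0] yA]].
  exists (fun v => y 0 (enum_rank v)).
    have /rV0Pn[i yi] := y0; exists (enum_val i); by rewrite enum_valK.
  move=> v; move/rowP: yA => /(_ (enum_rank v)); rewrite !mxE => <-.
  rewrite re; apply: eq_bigr => i _.
  by rewrite mxE enum_valK enum_rankK adj_sym mulrC.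
apply/eigenvalueP; exists (\row_i y (enum_val i)).
  apply/rowP => i; rewrite !mxE -yA re; apply: eq_bigr => j _.
  by rewrite !mxE adj_sym mulrC.
by apply/rV0Pn; exists (enum_rank v0); rewrite mxE enum_rankK.
Qed.

(** The condition [b != 0] rules out the default value 0 that [sup] takes when no supremum
    exists. *)
Lemma spectral_radius_eigenvalue (b : R) :
  spectral_radius R G = b -> b != 0 -> eigenvalue (adjacency_mx R G) b.
Proof.
rewrite /spectral_radius => <-; set E := [set _ | _]%classic => s0.
apply: (@sup_root R (char_poly (adjacency_mx R G)) E).
- by rewrite -size_poly_eq0 size_char_poly.
- by move=> e; rewrite /E /= eigenvalue_root_char.
- by apply: contrapT => /sup_out; apply/eqP.
Qed.

End Spectrum.

(** * The extremal join: its row sums, edge count and eigenvalue *)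

Section JoinSums.
Variables (R : realType) (k t : nat).
Local Notation J := (join_graph (complete_graph k) (edgeless_graph t)).

(** Action of the adjacency operator on vectors constant on each side of the join; used for degrees
    ([b = c = 1]) and for the eigenvector. *)
Lemma join_sum (p : J) (b c : R) :
  \sum_(q : J) (adj p q)%:R * (if q is inl _ then b else c) =
  if p is inl _ then (k%:R - 1) * b + t%:R * c else k%:R * b.
Proof.
rewrite big_sumType /=; case: p => i /=; last first.
  rewrite [X in _ + X]big1 ?addr0; last by move=> j _; rewrite mul0r.
  by under eq_bigr do rewrite mul1r; rewrite sumr_const card_ord mulr_natl.
congr (_ + _); last first.
  by under eq_bigr do rewrite mul1r; rewrite sumr_const card_ord mulr_natl.
rewrite -mulr_suml (bigD1 i) //= /complete_adj eqxx add0r; congr (_ * _).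
rewrite (eq_bigr (fun=> 1)) => [|j]; last by rewrite eq_sym => ->.
have := cardC1 i; rewrite card_ord => e; rewrite sumr_const e.
by rewrite -subn1 natrB // (leq_ltn_trans _ (ltn_ord i)).
Qed.

End JoinSums.

Section Isomorphism.
Variables (R : realType) (G : sgraph).

(** With two vertices in [C], every vertex of [C :|: J] has a neighbour in [C], so these are exactly
    the non-isolated vertices; enumerating [C] and [J] gives the isomorphism. *)
Lemma isomorphic_split (C J : {set G}) :
  [disjoint C & J] -> (2 <= #|C|)%N ->
  (forall p q, adj p q = (p != q) &&
      [|| (p \in C) && (q \in C), (p \in C) && (q \in J)
        | (p \in J) && (q \in C)]) ->
  isomorphic (drop_isolated G)
    (join_graph (complete_graph #|C|) (edgeless_graph #|J|)).
Proof.
move=> dCJ C2 adjE.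
have CJ p : p \in C -> p \in J = false by apply: disjointFr.
have niso p : [exists q, adj p q] = (p \in C :|: J).
  apply/existsP/idP => [[q]|pCJ].
    by rewrite adjE inE => /andP[_ /or3P[]/andP[-> _]]; rewrite ?orbT.
  have [q qC pq] : exists2 q, q \in C & q != p.
    have : (0 < #|C :\ p|)%N by have := cardsD1 p C; case: (p \in C); lia.
    by case/card_gt0P => q; rewrite !inE => /andP[? ?]; exists q.
  by exists q; rewrite adjE eq_sym pq /= qC; move: pCJ; rewrite inE => /orP[]->; rewrite ?orbT.
pose h (z : 'I_#|C| + 'I_#|J|) : G :=
  match z with inl i => enum_val i | inr i => enum_val i end.
have hP z : [exists q, adj (h z) q].
  by rewrite niso inE; case: z => i /=; rewrite enum_valP ?orbT.
pose g z : drop_isolated G := exist _ (h z) (hP z).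
have g_inj : injective g.
  move=> z z' /(congr1 val) /=; case: z z' => i [] j /=.
  - by move/enum_val_inj ->.
  - by move=> e; have := CJ _ (enum_valP i); rewrite e enum_valP.
  - by move=> e; have := CJ _ (enum_valP j); rewrite -e enum_valP.
  - by move/enum_val_inj ->.
(* Injectivity suffices, since [C :|: J] has at most [#|C| + #|J|] elements. *)
have [f gK fK] : bijective g.
  apply: inj_card_bij g_inj _; rewrite card_sum !card_ord card_sig.
  rewrite (@eq_card _ _ (C :|: J) niso).
  by rewrite cardsU leq_subr.
exists f; split; first by exists g.
have adjg z z' : adj (g z) (g z') =
  @adj (join_graph (complete_graph #|C|) (edgeless_graph #|J|)) z z'.
  rewrite /= /noniso_adj /= adjE.
  case: z z' => i [] j /=; rewrite !enum_valP.
  - by rewrite /= andbT (inj_eq enum_val_inj).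
  - by rewrite /= orbT andbT; apply/eqP => e; have := CJ _ (enum_valP i); rewrite e enum_valP.
  - by rewrite /= !orbT andbT; apply/eqP => e; have := CJ _ (enum_valP j); rewrite -e enum_valP.
  - have nJ (l : 'I_#|J|) : enum_val l \in C = false.
      by apply/negP => /CJ; rewrite enum_valP.
    by rewrite !nJ !andbF.
by move=> p q; rewrite -adjg !fK.
Qed.

Variables (k t : nat).
Local Notation J := (join_graph (complete_graph k) (edgeless_graph t)).
Hypothesis iso : isomorphic (drop_isolated G) J.

(** Transfer between the join and [G]: [h] embeds the join, and [y] extends functions by zero to the
    isolated vertices. *)
Lemma isomorphic_embedding : exists (h : J -> G) (y : (J -> R) -> G -> R),
  [/\ forall p q, adj (h p) (h q) = adj p q,
      forall F : G -> R, (forall v, ~~ [exists w, adj v w] -> F v = 0) ->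
        \sum_v F v = \sum_p F (h p),
      forall Y p, y Y (h p) = Y p &
      forall v, (exists p, v = h p) \/
        ~~ [exists w, adj v w] /\ forall Y, y Y v = 0].
Proof.
case: iso => f [[g fK gK] fadj].
exists (fun p => val (g p)).
exists (fun Y v => if insub v is Some z then Y (f z) else 0); split.
- by move=> p q; rewrite -[LHS]/(adj (g p) (g q)) -fadj !gK.
- move=> F F0; rewrite (bigID (fun v => [exists w, adj v w])) /= [X in _ + X]big1 // addr0.
  rewrite (@big_sub _ _ _ _ (fun v : G => [exists w, adj v w])).
  by rewrite (reindex g) //; exists f => z _; rewrite ?gK ?fK.
- by move=> Y p; rewrite valK gK.
- move=> v; case: (boolP [exists w, adj v w]) => hv; [left|right].
    by exists (f (exist _ v hv)); rewrite fK.
  by split=> // Y; rewrite insubN.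
Qed.

Lemma edges_isomorphic : 2 * #|edges G|%:R = k%:R * (k%:R - 1) + 2 * k%:R * t%:R :> R.
Proof.
have [h [_ [hadj hsum _ _]]] := isomorphic_embedding.
have sumh (v : G) : \sum_(w : G) (adj v w)%:R = \sum_p (adj v (h p))%:R :> R.
  apply: hsum => w; rewrite negb_exists => /forallP/(_ v).
  by rewrite adj_sym => /negbTE ->.
rewrite -natrM -handshake natr_sum; under eq_bigr do rewrite natr_sum sumh.
rewrite hsum; last first.
  move=> v; rewrite negb_exists => /forallP hv; apply: big1 => p _.
  by rewrite (negbTE (hv _)).
have e (p : J) : \sum_q (adj (h p) (h q))%:R =
   if p is inl _ then (k%:R - 1) * 1 + t%:R * 1 else k%:R * 1 :> R.
  rewrite -join_sum; apply: eq_bigr => q _; rewrite hadj.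
  by case: q => ?; rewrite mulr1.
rewrite (eq_bigr _ (fun p _ => e p)) big_sumType /= !sumr_const !card_ord.
rewrite -[_ *+ k]mulr_natl -[_ *+ t]mulr_natl.
ring.
Qed.

(** The eigenvector is [b] on the clique and [k] on the independent set; the quadratic is its
    equation at a clique vertex. *)
Lemma eigenvalue_isomorphic (b : R) :
  (0 < k)%N -> b != 0 -> b ^+ 2 = (k%:R - 1) * b + k%:R * t%:R ->
  eigenvalue (adjacency_mx R G) b.
Proof.
move=> k0 b0 bE; apply/eigenvalue_adjacencyP.
have [h [y [hadj hsum yh hsurj]]] := isomorphic_embedding.
pose Y (p : J) : R := if p is inl _ then b else k%:R.
exists (y Y); first by exists (h (inl (Ordinal k0))); rewrite yh.
move=> v; have [[p ->]|[]] := hsurj v; last first.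
  rewrite negb_exists => /forallP hv ->; rewrite mulr0; apply: big1 => w _.
  by rewrite (negbTE (hv w)) mul0r.
rewrite hsum => [|w]; last first.
  by rewrite negb_exists adj_sym => /forallP/(_ (h p))/negbTE ->; rewrite mul0r.
under eq_bigr do rewrite yh hadj; rewrite yh /Y join_sum.
by case: p => i; rewrite -?expr2 ?bE; ring.
Qed.

End Isomorphism.

(** * The numerical bound and the eigenvalues that reach it *)

(** The radicand is the discriminant [(k-1)^2 + 4(m - k(k-1)/2)]. By [m >= 4k^4] it exceeds
    [(9(k-1))^2], and [(1+9)/2 = 5]. *)
Lemma bound_quadratic (R : realType) (k m : nat) :
  (2 <= k)%N -> (4 * k ^ 4 <= m)%N ->
  let b : R := (k%:R - 1 + Num.sqrt (4 * m%:R - k%:R ^+ 2 + 1)) / 2 in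
  5 * (k%:R - 1) < b /\ b ^+ 2 - (k%:R - 1) * b = m%:R - k%:R * (k%:R - 1) / 2.
Proof.
move=> k2 hm b; pose K : R := k%:R; pose D : R := 4 * m%:R - K ^+ 2 + 1.
have K2 : 2 <= K by rewrite ler_nat.
have mK : 4 * K ^+ 4 <= m%:R by rewrite /K -natrX -natrM ler_nat.
(* The hints for [nra] all come from [K^2 >= 4(K-1)] and [K >= 2]. *)
have DK : (9 * (K - 1)) ^+ 2 < D.
  have h1 : 0 <= (K - 2) ^+ 2 by apply: sqr_ge0.
  have h2 : 0 <= K ^+ 2 * (K ^+ 2 - 4 * (K - 1)) by rewrite mulr_ge0 ?sqr_ge0 //; lra.
  have h3 : 0 <= (K - 1) * (K ^+ 2 - 4 * (K - 1)) by rewrite mulr_ge0 //; lra.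
  have h4 : 0 <= (K - 1) * (K - 2) by rewrite mulr_ge0; lra.
  have h5 : 0 <= K ^+ 2 * ((K - 1) * (K - 2)) by rewrite mulr_ge0 ?sqr_ge0.
  rewrite /D; nra.
have D0 : 0 <= D by apply: le_trans (ltW DK); apply: sqr_ge0.
have sD := sqr_sqrtr D0.
have sgt : 9 * (K - 1) < Num.sqrt D.
  by rewrite -ltr_sqr ?nnegrE ?sqrtr_ge0 ?sD //; lra.
have bE : b = (K - 1 + Num.sqrt D) / 2 by [].
split; first by rewrite bE -/K; lra.
rewrite bE -/K expr2; move: sD; rewrite /D expr2; lra.
Qed.

Section EigenvalueBound.
Variables (R : realType) (G : sgraph) (k : nat) (b c : R).
Hypothesis k2 : (2 <= k)%N.
Hypothesis free : ~ contains_subgraph G (friendship_graph k).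
Hypothesis b_gt : 5 * (k%:R - 1) < b.
Hypothesis bE : b ^+ 2 - (k%:R - 1) * b = #|edges G|%:R - k%:R * (k%:R - 1) / 2.

(** The moduli of an eigenvector, divided by the largest one, satisfy the hypotheses of
    [local_structure] by the triangle inequality. *)
Lemma eigenvalue_extremal :
  eigenvalue (adjacency_mx R G) c -> b <= c ->
  c = b /\ exists t, isomorphic (drop_isolated G)
                       (join_graph (complete_graph k) (edgeless_graph t)).
Proof.
move=> /eigenvalue_adjacencyP[y [v0 yv0] yE] bc.
have K2 : 2 <= k%:R :> R by rewrite ler_nat.
have bk : 5 * (k%:R - 1) < b := b_gt.
have c0 : 0 <= c by lra.
case: (@arg_maxP _ _ G v0 xpredT (fun v => `|y v|) isT) => u _ umax.
have yu : 0 < `|y u| by apply: lt_le_trans (umax v0 isT); rewrite normr_gt0.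
pose x v := `|y v| / `|y u|.
have sub v : c * x v <= \sum_w (adj v w)%:R * x w.
  rewrite /x mulrA.
  under eq_bigr do rewrite mulrA.
  rewrite -mulr_suml ler_pM2r ?invr_gt0 //.
  rewrite -[c](ger0_norm c0) -normrM -yE; apply: le_trans (ler_norm_sum _ _ _) _.
  by apply: ler_sum => w _; rewrite normrM normr_nat.
have [|||||cE [C [J [dCJ CK adjE]]]] :=
  @local_structure R G k u k2 free x c _ _ _ sub _ _.
- by move=> v; rewrite divr_ge0.
- by move=> v; rewrite ler_pdivrMr // mul1r; apply: umax.
- by rewrite /x divff // gt_eqF.
- by apply: lt_le_trans bc.
(* The product is the increase of [X^2 - (k-1) X] from [b] to [c]. *)
- rewrite -bE; have : 0 <= (c - b) * (c + b - (k%:R - 1)) by rewrite mulr_ge0; lra.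
  rewrite !expr2; lra.
split; last by exists #|J|; rewrite -{1}CK; apply: isomorphic_split; rewrite ?CK.
have /eqP : (c - b) * (c + b - (k%:R - 1)) = 0 by move: cE; rewrite -bE !expr2; lra.
by rewrite mulf_eq0 => /orP[]/eqP; lra.
Qed.

End EigenvalueBound.

Theorem theorem1p5 (R : realType) (k m : nat) (G : sgraph)
    (hk : (2 <= k)%N) (hm : (4 * k ^ 4 <= m)%N)
    (hG : #|edges G| = m)
    (hfree : ~ contains_subgraph G (friendship_graph k)) :
  let bound : R :=
    (k%:R - 1 + Num.sqrt (4 * m%:R - k%:R ^+ 2 + 1)) / 2 in
  spectral_radius R G <= bound /\
  (spectral_radius R G = bound <->
   exists t : nat, t%:R = m%:R / k%:R - (k%:R - 1) / 2 :> R /\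
     isomorphic (drop_isolated G)
       (join_graph (complete_graph k) (edgeless_graph t))).
Proof.
move=> bound; have [] := bound_quadratic R hk hm; rewrite -/bound => b_gt bE.
have K2 : 2 <= k%:R :> R by rewrite ler_nat.
have b0 : 0 < bound by lra.
have ext c := @eigenvalue_extremal R G k bound c hk hfree b_gt.
rewrite hG in ext.
have ub c : eigenvalue (adjacency_mx R G) c -> c <= bound.
  move=> ec; rewrite leNgt; apply/negP => lt.
  by have [e _] := ext c bE ec (ltW lt); rewrite e ltxx in lt.
have le : spectral_radius R G <= bound.
  rewrite /spectral_radius; set E := (X in sup X).
  (* Without a supremum, [sup E] is 0, which is below the positive bound. *)
  have [ne|/sup_out ->] := pselect (has_sup E); last exact: ltW.
  by apply: ge_sup => //; case: ne.
split=> //; split=> [srE|[t [tE iso]]].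
  have eb := spectral_radius_eigenvalue srE (lt0r_neq0 b0).
  have [_ [t iso]] := ext _ bE eb (lexx _).
  (* The value of [t] is dictated by the edge count of the join. *)
  exists t; split=> //; have := edges_isomorphic R iso; rewrite hG => e.
  have k0 : k%:R != 0 :> R by rewrite gt_eqF //; lra.
  apply: (mulfI k0); rewrite mulrBr [k%:R * (_ / _)]mulrC divfK //; lra.
(* Conversely, [bound] is itself an eigenvalue of the join, hence at most the supremum. *)
apply/eqP; rewrite eq_le le /=; apply: ub_le_sup; first by exists bound => c /ub.
apply: (eigenvalue_isomorphic iso); [exact: ltnW|exact: lt0r_neq0|].
have := edges_isomorphic R iso; rewrite hG; move: bE; lra.
Qed.
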